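(* There is a polynomial-time (greedy) algorithm that, given a caterpillar $T$ and a positive integer $k$, outputs an optimal solution to $\textsc{Cover}(T,k)$, i.e. subsets $V_1,\dots,V_k$ of the vertex set of $T$ such that every edge of $T$ has both endpoints in some $V_i$ and $\max_i|V_i|$ is the minimum possible over all such choices.
   Context: A caterpillar is a tree $T$ such that deleting all leaves of $T$ leaves a single path. For a graph $G=(V,E)$ and integer $k\ge1$, $\textsc{Cover}(G,k)$ is the problem of choosing subsets $V_1,\dots,V_k\subseteq V$ such that every edge of $G$ has both endpoints in some $V_i$ (the induced subgraphs $G[V_i]$ together cover $G$), minimizing $\max_i|V_i|$. *)

(* Defs.v *)
From mathcomp Require Import all_boot.

Set Implicit Arguments.
Unset Strict Implicit.
Unset Printing Implicit Defensive.

(** * Graphs, caterpillars and the covering problem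

   A finite simple graph is a symmetric irreflexive relation on a finite type
   of vertices. *)

Section Graphs.

Variables (V : finType) (e : rel V).

Definition simple_graph : Prop := symmetric e /\ irreflexive e.

Definition connected_graph : Prop := forall x y, connect e x y.

(* An edge traversed back and forth is a [ucycle] of size 2. *)
Definition acyclic : Prop := forall c : seq V, ucycle e c -> size c < 3.

Definition is_tree : Prop :=
  [/\ simple_graph, 0 < #|V|, connected_graph & acyclic].

Definition degree (x : V) : nat := #|[set y | e x y]|.

Definition leaves : {set V} := [set x | degree x == 1].

(* The subgraph induced by S is isomorphic to the path on m vertices.  The
   empty path m = 0 is allowed: it is what remains of a single edge once its
   two leaves are deleted. *)
Definition induces_path (S : {set V}) : Prop :=
  exists (m : nat) (f : 'I_m -> V),
    [/\ injective f, S = [set f i | i in 'I_m]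
      & forall i j : 'I_m, e (f i) (f j) = (i.+1 == j) || (j.+1 == i)].

Definition caterpillar : Prop := is_tree /\ induces_path (~: leaves).

Section Cover.

Variable k : nat.

Definition is_cover (W : 'I_k -> {set V}) : Prop :=
  forall x y, e x y -> exists i, x \in W i /\ y \in W i.

Definition cover_cost (W : 'I_k -> {set V}) : nat := \max_(i < k) #|W i|.

Definition optimal_cover (W : 'I_k -> {set V}) : Prop :=
  is_cover W /\ forall W', is_cover W' -> cover_cost W <= cover_cost W'.

End Cover.

End Graphs.

(** * Model of computation

   Random access machine, in structured form: a program uses finitely many
   integer variables and integer arrays, all named statically.  Every constant,
   variable access, array access, addition, subtraction and test costs one time
   unit.  Since there is no multiplication, a run of length t only
   creates integers whose bit length exceeds that of the input by O(t), so
   that polynomial time is the same here as on Turing machines. *)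

Inductive expr : Type :=
| Cst of nat
| Var of nat
| Get of nat & expr            (* Get a i : cell i of array a *)
| Add of expr & expr
| Sub of expr & expr.          (* truncated at 0 *)

Inductive cmd : Type :=
| Skip
| Assign of nat & expr
| Put of nat & expr & expr     (* Put a i v : cell i of array a receives v *)
| Seq of cmd & cmd
| If of expr & cmd & cmd       (* tests are "is nonzero" *)
| While of expr & cmd.

Record state : Type := State {
  var : nat -> nat;
  arr : nat -> nat -> nat
}.

Definition set_var (s : state) (x v : nat) : state :=
  State (fun y => if y == x then v else var s y) (arr s).

Definition set_cell (s : state) (a i v : nat) : state :=
  State (var s)
    (fun b j => if (b == a) && (j == i) then v else arr s b j).

Fixpoint eval (s : state) (u : expr) : nat :=
  match u with
  | Cst c => c
  | Var x => var s x
  | Get a i => arr s a (eval s i)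
  | Add u1 u2 => eval s u1 + eval s u2
  | Sub u1 u2 => eval s u1 - eval s u2
  end.

Fixpoint ecost (u : expr) : nat :=
  match u with
  | Cst _ | Var _ => 1
  | Get _ i => (ecost i).+1
  | Add u1 u2 | Sub u1 u2 => (ecost u1 + ecost u2).+1
  end.

(* exec c s t s' : started in state s, program c halts in state s' after
   exactly t time units. *)
Inductive exec : cmd -> state -> nat -> state -> Prop :=
| ExecSkip s : exec Skip s 1 s
| ExecAssign s x u :
    exec (Assign x u) s (ecost u).+1 (set_var s x (eval s u))
| ExecPut s a i v :
    exec (Put a i v) s (ecost i + ecost v).+1
      (set_cell s a (eval s i) (eval s v))
| ExecSeq s1 s2 s3 c1 c2 t1 t2 :
    exec c1 s1 t1 s2 -> exec c2 s2 t2 s3 ->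
    exec (Seq c1 c2) s1 (t1 + t2) s3
| ExecIfT s s' u c1 c2 t :
    eval s u != 0 -> exec c1 s t s' ->
    exec (If u c1 c2) s ((ecost u).+1 + t) s'
| ExecIfF s s' u c1 c2 t :
    eval s u = 0 -> exec c2 s t s' ->
    exec (If u c1 c2) s ((ecost u).+1 + t) s'
| ExecWhileF s u c :
    eval s u = 0 -> exec (While u c) s (ecost u).+1 s
| ExecWhileT s1 s2 s3 u c t1 t2 :
    eval s1 u != 0 -> exec c s1 t1 s2 -> exec (While u c) s2 t2 s3 ->
    exec (While u c) s1 ((ecost u).+1 + t1 + t2) s3.

Lemma exec_det c s t1 s1 t2 s2 :
  exec c s t1 s1 -> exec c s t2 s2 -> t1 = t2 /\ s1 = s2.
Proof.
move=> h; elim: h t2 s2 => {c s t1 s1} => [s|s x u|s a i v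
  |s s2 s3 c1 c2 t1 t2 _ IH1 _ IH2|s s' u c1 c2 t nz _ IH
  |s s' u c1 c2 t z _ IH|s u c z|s s2 s3 u c t1 t2 nz _ IH1 _ IH2] t' s'' h;
  inversion h as [| | |? ? ? ? ? ? ? h1 h2|? ? ? ? ? ? z1 h1|? ? ? ? ? ? z1 h1
    |? ? ? z1|? ? ? ? ? ? ? z1 h1 h2]; subst => //;
  try by [rewrite z in z1 | rewrite z1 in nz].
- by have [? ?] := IH1 _ _ h1; subst; have [? ?] := IH2 _ _ h2; subst.
- by have [-> ->] := IH _ _ h1.
- by have [-> ->] := IH _ _ h1.
- by have [? ?] := IH1 _ _ h1; subst; have [? ?] := IH2 _ _ h2; subst.
Qed.

(** * Encoding of instances and solutions *)

(* Variable 0 holds n, variable 1 holds k and array 0 holds the adjacency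
   matrix of e, row by row; everything else is 0. *)
Definition input (n k : nat) (e : rel 'I_n) : state :=
  State
    (fun x => if x == 0 then n else if x == 1 then k else 0)
    (fun a p => if a == 0
       then nat_of_bool
              [exists i : 'I_n, exists j : 'I_n, (p == i * n + j) && e i j]
       else 0).

(* Number of bits of an instance: the n * n entries of the matrix and the
   binary digits of k (k > 0). *)
Definition input_size (n k : nat) : nat := n * n + (trunc_log 2 k).+1.

(* Array 1 holds the k x n membership matrix of the sets, row by row: vertex x
   belongs to the i-th set when cell i * n + x is nonzero. *)
Definition output (n k : nat) (s : state) (i : 'I_k) : {set 'I_n} :=
  [set x : 'I_n | arr s 1 (i * n + x) != 0].

(* Main.v *)
Require Import Defs.
From mathcomp Require Import all_boot zify.

Set Implicit Arguments.
Unset Strict Implicit.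
Unset Printing Implicit Defensive.

(** Walk along the spine, listing for each spine vertex the edges to its leaves
   and then the edge to the next spine vertex.  In this order any q consecutive
   edges span at most q + 1 vertices, so cutting the list into pieces of
   q = ceil((n - 1) / k) edges gives k sets of at most q + 1 vertices.
   Conversely a nonempty set S contains at most |S| - 1 edges of a forest, so k
   sets of at most M vertices cover at most k (M - 1) edges; hence q + 1 is
   optimal as soon as there is an edge.

   The machine program is written with loops over [0, n) only, which gives it a
   total semantics [run] and a polynomial running time by structural
   induction. *)

(** * Bounded loop programs *)

Inductive prog : Type :=
| PSkip
| PAssign of nat & expr
| PPut of nat & expr & expr
| PSeq of prog & prog
| PIf of expr & prog & prog
| PFor of nat & prog.

(** Variable 0 holds [n]; subtraction being truncated, the loop guard is nonzero exactly while the
    counter is below [n]. *)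
Fixpoint compile (p : prog) : cmd :=
  match p with
  | PSkip => Skip
  | PAssign x u => Assign x u
  | PPut a i v => Put a i v
  | PSeq p1 p2 => Seq (compile p1) (compile p2)
  | PIf u p1 p2 => If u (compile p1) (compile p2)
  | PFor x p => Seq (Assign x (Cst 0))
      (While (Defs.Sub (Var 0) (Var x))
         (Seq (compile p) (Assign x (Add (Var x) (Cst 1)))))
  end.

Fixpoint run (p : prog) (s : state) : state :=
  match p with
  | PSkip => s
  | PAssign x u => set_var s x (eval s u)
  | PPut a i v => set_cell s a (eval s i) (eval s v)
  | PSeq p1 p2 => run p2 (run p1 s)
  | PIf u p1 p2 => if eval s u != 0 then run p1 s else run p2 s
  | PFor x p =>
      iter (var s 0) (fun s1 => set_var (run p s1) x (var (run p s1) x).+1)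
        (set_var s x 0)
  end.

Fixpoint assigned (p : prog) : seq nat :=
  match p with
  | PSkip | PPut _ _ _ => [::]
  | PAssign x _ => [:: x]
  | PSeq p1 p2 | PIf _ p1 p2 => assigned p1 ++ assigned p2
  | PFor x p => x :: assigned p
  end.

Fixpoint written (p : prog) : seq nat :=
  match p with
  | PSkip | PAssign _ _ => [::]
  | PPut a _ _ => [:: a]
  | PSeq p1 p2 | PIf _ p1 p2 => written p1 ++ written p2
  | PFor _ p => written p
  end.

(** A loop body can change neither the bound in variable 0 nor its own counter, so the compiled
    [While] makes exactly the number of passes fixed in [run]. *)
Fixpoint well_formed (p : prog) : bool :=
  match p with
  | PSkip | PPut _ _ _ => true
  | PAssign x _ => x != 0
  | PSeq p1 p2 | PIf _ p1 p2 => well_formed p1 && well_formed p2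
  | PFor x p =>
      [&& well_formed p, x != 0 & x \notin assigned p]
  end.

(** In a loop, 6 is 2 for resetting the counter plus 4 for the last, failing test; 8 is 4 for a
    successful test plus 4 for the increment. A conditional is charged both branches, so that the
    bound does not depend on the state. *)
Fixpoint time (p : prog) (n : nat) : nat :=
  match p with
  | PSkip => 1
  | PAssign _ u => (ecost u).+1
  | PPut _ i v => (ecost i + ecost v).+1
  | PSeq p1 p2 => time p1 n + time p2 n
  | PIf u p1 p2 => (ecost u).+1 + (time p1 n + time p2 n)
  | PFor _ p => 6 + n * (time p n + 8)
  end.

Lemma run_var p s y : y \notin assigned p -> var (run p s) y = var s y.
Proof.
elim: p s => [|x u|a i v|p1 IH1 p2 IH2|u p1 IH1 p2 IH2|x p IH] s //=.
- by rewrite inE => /negPf ->.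
- by rewrite mem_cat negb_or => /andP[h1 h2]; rewrite IH2 ?IH1.
- by rewrite mem_cat negb_or => /andP[h1 h2]; case: ifP => _; rewrite ?IH2 ?IH1.
rewrite inE negb_or => /andP[/negPf nyx yp].
elim: (var s 0) => [|m IHm] /=; first by rewrite nyx.
by rewrite nyx IH.
Qed.

Lemma run_arr p s a : a \notin written p -> arr (run p s) a = arr s a.
Proof.
elim: p s => [|x u|b i v|p1 IH1 p2 IH2|u p1 IH1 p2 IH2|x p IH] s //=.
- by rewrite inE => /negPf ->.
- by rewrite mem_cat negb_or => /andP[h1 h2]; rewrite IH2 ?IH1.
- by rewrite mem_cat negb_or => /andP[h1 h2]; case: ifP => _; rewrite ?IH2 ?IH1.
by move=> ap; elim: (var s 0) => [|m IHm] //=; rewrite IH.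
Qed.

Lemma well_formed_size p : well_formed p -> 0 \notin assigned p.
Proof.
elim: p => [|x u|a i v|p1 IH1 p2 IH2|u p1 IH1 p2 IH2|x p IH] //=.
- by rewrite inE eq_sym.
- by case/andP=> /IH1 h1 /IH2 h2; rewrite mem_cat negb_or h1.
- by case/andP=> /IH1 h1 /IH2 h2; rewrite mem_cat negb_or h1.
by case/and3P=> /IH h x0 _; rewrite inE negb_or eq_sym x0.
Qed.

Lemma exec_compile p s : well_formed p ->
  exists2 t, exec (compile p) s t (run p s) & t <= time p (var s 0).
Proof.
elim: p s => [|x u|a i v|p1 IH1 p2 IH2|u p1 IH1 p2 IH2|x p IH] s /=.
- by exists 1 => //; exact: ExecSkip.
- by move=> _; eexists; [exact: ExecAssign|].
- by move=> _; eexists; [exact: ExecPut|].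
- case/andP=> w1 w2; have [t1 h1 l1] := IH1 s w1.
  have [t2 h2] := IH2 (run p1 s) w2; rewrite run_var ?well_formed_size // => l2.
  by exists (t1 + t2); [exact: ExecSeq h1 h2|exact: leq_add].
- case/andP=> w1 w2; case: ifP => [nz|/negbFE/eqP z].
    have [t h l] := IH1 s w1; exists ((ecost u).+1 + t); first exact: ExecIfT.
    by lia.
  have [t h l] := IH2 s w2; exists ((ecost u).+1 + t); first exact: ExecIfF.
  by lia.
case/and3P=> w x0 xp; set body := (fun s1 => set_var _ _ _); set c := While _ _.
have /negPf x0' : 0 != x by rewrite eq_sym.
(* Generalised to a loop already under way with [m] passes left, so that induction on [m]
   applies. *)
suff W m s1 : var s1 0 = var s1 x + m -> exists2 t,
    exec c s1 t (iter m body s1) & t <= 4 + m * (time p (var s1 0) + 8).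
  have e0 : var (set_var s x 0) 0 = var s 0 by rewrite /= x0'.
  have [] := W (var s 0) (set_var s x 0); first by rewrite /= eqxx x0'.
  rewrite e0 => t h l; exists (2 + t); last by lia.
  by apply: ExecSeq h; exact: ExecAssign.
elim: m s1 => [|m IHm] s1 h.
  by exists 4 => //; apply: ExecWhileF => /=; lia.
have [t1 h1 l1] := IH s1 w; have p0 := well_formed_size w.
have e0 : var (body s1) 0 = var s1 0 by rewrite /body /= x0' run_var.
have ex : var (body s1) x = (var s1 x).+1 by rewrite /body /= eqxx run_var.
have [|t2 h2 l2] := IHm (body s1); first by rewrite e0 ex; lia.
exists (4 + (t1 + 4) + t2); last by rewrite e0 in l2; lia.
rewrite iterSr; apply: ExecWhileT h2; first by rewrite /=; lia.
apply: ExecSeq h1 _; rewrite /body -[in X in set_var _ _ X]addn1.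
exact: (ExecAssign _ _ (Add _ _)).
Qed.

(** The base [n.+1] is positive, so a larger exponent only weakens a bound; sequences add
    coefficients and exponents, and a loop raises the degree by one. *)
Lemma time_poly p : exists a d, forall n, time p n <= a * n.+1 ^ d.
Proof.
have up a d d' n : a * n.+1 ^ d <= a * n.+1 ^ (d + d').
  by rewrite leq_mul2l leq_pexp2l ?orbT ?leq_addr.
elim: p => [|x u|a i v|p1 [a1 [d1 h1]] p2 [a2 [d2 h2]]
  |u p1 [a1 [d1 h1]] p2 [a2 [d2 h2]]|x p [a [d h]]] /=.
- by exists 1, 0.
- by exists (ecost u).+1, 0 => n; rewrite expn0 muln1.
- by exists (ecost i + ecost v).+1, 0 => n; rewrite expn0 muln1.
- exists (a1 + a2), (d1 + d2) => n; rewrite mulnDl.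
  apply: leq_add; first exact: leq_trans (h1 n) (up _ _ _ _).
  by rewrite addnC; exact: leq_trans (h2 n) (up _ _ _ _).
- exists ((ecost u).+1 + (a1 + a2)), (d1 + d2) => n; rewrite !mulnDl.
  apply: leq_add; first by rewrite leq_pmulr // expn_gt0.
  apply: leq_add; first exact: leq_trans (h1 n) (up _ _ _ _).
  by rewrite addnC; exact: leq_trans (h2 n) (up _ _ _ _).
exists (6 + (a + 8)), d.+1 => n; rewrite mulnDl; apply: leq_add.
  by rewrite leq_pmulr // expn_gt0.
rewrite expnS mulnCA; apply: leq_mul => //; rewrite mulnDl.
by apply: leq_add; rewrite // leq_pmulr // expn_gt0.
Qed.

(** * Frame conditions and loop invariants *)

Definition agree (p : prog) (s s1 : state) : Prop :=
  (forall y, y \notin assigned p -> var s1 y = var s y) /\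
  (forall a, a \notin written p -> arr s1 a = arr s a).

(** Hoare rule for loops. Each pass may also assume the frame condition relative to the initial
    state, so invariants mention only what the loop changes. *)
Lemma run_for (I : nat -> state -> Prop) x p s :
  well_formed (PFor x p) -> I 0 (set_var s x 0) ->
  (forall j s1, j < var s 0 -> agree (PFor x p) s s1 -> var s1 x = j ->
     I j s1 -> I j.+1 (set_var (run p s1) x j.+1)) ->
  I (var s 0) (run (PFor x p) s).
Proof.
case/and3P=> w x0 xp I0 IS /=; set body := (fun s1 => set_var _ _ _).
suff H m : m <= var s 0 -> let s1 := iter m body (set_var s x 0) in
    [/\ I m s1, agree (PFor x p) s s1 & var s1 x = m].
  by case: (H _ (leqnn _)).
elim: m => [|m IHm] hm /=.
  by rewrite eqxx; split=> //; split=> y //=;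
    rewrite inE negb_or => /andP[/negPf ->].
have [hI hs hx] := IHm (ltnW hm).
rewrite {1 3}/body /= eqxx !run_var // hx; split=> //; first exact: IS.
case: hs => hv ha; split=> [y|a] h.
  have := hv _ h; move: h; rewrite /= inE negb_or => /andP[/negPf -> hy].
  by rewrite run_var.
by rewrite /= run_arr // ha.
Qed.

Definition Sum (z acc : nat) (u : expr) : prog :=
  PSeq (PAssign acc (Cst 0)) (PFor z (PAssign acc (Add (Var acc) u))).

Lemma run_sum n (F : 'I_n -> nat) z acc u s :
  well_formed (Sum z acc u) -> var s 0 = n ->
  (forall (j : 'I_n) s1, agree (Sum z acc u) s s1 -> var s1 z = j ->
     eval s1 u = F j) ->
  var (run (Sum z acc u) s) acc = \sum_(j < n) F j.
Proof.
(* [F'] extends [F] by 0 beyond [n], so that partial sums make sense for every natural number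
   [j]. *)
case/andP=> acc0 w hn hF; pose F' j := oapp F 0 (insub j).
have F'E (j : 'I_n) : F j = F' j by rewrite /F' valK.
under eq_bigr do rewrite F'E.
have n0 : var (set_var s acc 0) 0 = n by rewrite /= eq_sym (negPf acc0).
have /and3P[_ _] := w; rewrite inE eq_sym => /negPf nz.
rewrite -[run _ _]/(run (PFor z (PAssign acc (Add (Var acc) u))) (set_var s
  acc 0)).
rewrite -[in RHS]n0.
apply: (run_for (I := fun j s1 => var s1 acc = \sum_(i < j) F' i)) => //.
  by rewrite /= nz eqxx big_ord0.
move=> j s1; rewrite n0 => lt_j [hv ha] hz hI.
rewrite /= nz eqxx big_ord_recr /= hI -(F'E (Ordinal lt_j)); congr (_ + _).
apply: (hF (Ordinal lt_j)) hz; split=> [y hy|a /ha //].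
rewrite (hv y); last by move: hy; rewrite /= !inE orbCA orbb.
by move: hy; rewrite /= inE negb_or => /andP[/negPf ->].
Qed.

Lemma run_seq p1 p2 s : run (PSeq p1 p2) s = run p2 (run p1 s).
Proof. by []. Qed.

Lemma run_if u p1 p2 s :
  run (PIf u p1 p2) s = if eval s u != 0 then run p1 s else run p2 s.
Proof. by []. Qed.

Lemma run_assign x u s : run (PAssign x u) s = set_var s x (eval s u).
Proof. by []. Qed.

Lemma run_put a i v s : run (PPut a i v) s = set_cell s a (eval s i) (eval s v).
Proof. by []. Qed.

Lemma run_skip s : run PSkip s = s.
Proof. by []. Qed.

Definition runE := (run_seq, run_if, run_assign, run_put, run_skip).

Arguments run : simpl never.

(** * Cutting an edge order into blocks *)

Section Chunks.

Variables (T : eqType) (q : nat).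
Implicit Types (L : seq T) (p : T).

Definition chunk L i : seq T := take q (drop (i * q) L).

(** The new element has position [size L]: earlier chunks are already full, and later ones start
    beyond it. *)
Lemma chunk_rcons L p i : 0 < q ->
  chunk (rcons L p) i =
    if i == size L %/ q then rcons (chunk L i) p else chunk L i.
Proof.
move=> q0; rewrite /chunk; have [lt_i|ge_i] := ltnP (size L) (i * q).
  rewrite !drop_oversize ?size_rcons ?(ltnW lt_i) //= ifN //.
  by apply: contraTneq lt_i => ->; rewrite -leqNgt leq_divM.
rewrite drop_rcons //; case: eqP => [ei|nei].
  have lt_q : size (drop (i * q) L) < q.
    by rewrite size_drop ei; have := divn_eq (size L) q;
      have := ltn_mod (size L) q;
    lia.
  by rewrite !take_oversize // ?size_rcons // ltnW.
have le_q : q <= size (drop (i * q) L).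
  have : i <= size L %/ q by rewrite leq_divRL.
  rewrite leq_eqVlt; case/predU1P=> // lt_i.
  by rewrite size_drop leq_subRL // addnC -mulSn -leq_divRL.
by rewrite -cats1 takel_cat.
Qed.

Lemma mem_chunk L p : 0 < q -> p \in L ->
  p \in chunk L (index p L %/ q).
Proof.
move=> q0 pL; have lt_j : index p L < size L by rewrite index_mem.
have ej := divn_eq (index p L) q; have lt_m := ltn_pmod (index p L) q0.
have : index p L %% q < size (chunk L (index p L %/ q)).
  by rewrite size_take size_drop; case: ifP; lia.
by move/(mem_nth p); rewrite nth_take // nth_drop -ej nth_index.
Qed.

End Chunks.

(** * Edge orders: size of the blocks and the matching lower bound *)

Section EdgeOrders.

Variables (V : finType) (e : rel V).
Implicit Types (L : seq (V * V)) (p : V * V) (r : V) (S : {set V}).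

Definition follows : rel (V * V) := fun p p' => p'.1 \in [:: p.1; p.2].

Definition block q L i : {set V} :=
  [set x in unzip1 (chunk q L i) ++ unzip2 (chunk q L i)].

(** Each first component is an end of the preceding pair, hence by induction the very first vertex
    or some second component. So a run of pairs spans at most one vertex more than it has pairs. *)
Lemma sub_unzip1 p L : path follows p L ->
  {subset unzip1 (p :: L) <= p.1 :: unzip2 (p :: L)}.
Proof.
elim: L p => [|p' L IH] p /=; first by move=> _ x; rewrite !inE => ->.
case/andP=> hp /IH sub x; rewrite inE => /predU1P[->|/sub].
  by rewrite inE eqxx.
rewrite !inE; case/predU1P=> [->|]; last by move=> h; rewrite h !orbT.
by move: hp; rewrite /follows !inE => /orP[] ->; rewrite ?orbT.
Qed.

Lemma card_block q L i : sorted follows L -> #|block q L i| <= q.+1.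
Proof.
move=> sL; rewrite /block; have : sorted follows (chunk q L i).
  by rewrite take_sorted // drop_sorted.
have : size (chunk q L i) <= q by rewrite size_take; case: ifP => // /negbT;
  rewrite -leqNgt.
case: (chunk q L i) => [|p l] szl hl.
  by rewrite (_ : [set x in _] = set0) ?cards0 //; apply/setP=> x; rewrite !inE.
apply: (@leq_trans #|p.1 :: unzip2 (p :: l)|).
  apply: subset_leq_card; apply/subsetP=> x.
  rewrite inE mem_cat; case/orP=> [/(sub_unzip1 hl)//|h].
  by rewrite in_cons h orbT.
by apply: leq_trans (card_size _) _; rewrite /= size_map.
Qed.

(* A pair (u, w) of L is an edge whose child w is new and whose parent u is r or
   an earlier child; being an end of the previous pair keeps runs connected. *)
Record edge_order r L : Prop := EdgeOrder {
  eo_path : path follows (r, r) L;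
  eo_uniq : uniq (r :: unzip2 L);
  eo_edge : forall p, p \in L -> e p.1 p.2
}.

Lemma last_edge_order r L : path follows (r, r) L ->
  ((last (r, r) L).1 \in r :: unzip2 L) * ((last (r, r) L).2 \in r :: unzip2 L).
Proof.
move=> hL; suff h : last (r, r) L \in (r, r) :: L.
  split; last by have := map_f snd h; rewrite !inE.
  by have := sub_unzip1 hL (map_f fst h); rewrite !inE /= orbA orbb.
exact: mem_last.
Qed.

Lemma edge_order_rcons r L u w : edge_order r L ->
  u \in [:: (last (r, r) L).1; (last (r, r) L).2] ->
  w \notin r :: unzip2 L -> e u w -> edge_order r (rcons L (u, w)).
Proof.
case=> hp hu he hl nw euw; split.
- by rewrite rcons_path hp.
- by rewrite /unzip2 map_rcons -rcons_cons rcons_uniq nw.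
by move=> p; rewrite mem_rcons inE => /predU1P[->|/he].
Qed.

(* The first vertex of S in the order r, w_1, w_2, ... is not the child of a
   pair inside S. *)
Lemma count_inside r L S : edge_order r L ->
  count (fun p => (p.1 \in S) && (p.2 \in S)) L <= #|S|.-1.
Proof.
(* Counting only the vertices of [S] reached so far makes the bound inductive. *)
case=> hp hu _; suff : count (fun p => (p.1 \in S) && (p.2 \in S)) L
    <= #|[set x in S | x \in r :: unzip2 L]|.-1.
  move/leq_trans; apply;
    have := subset_leq_card (_ : [set x in S | x \in r :: unzip2 L] \subset S).
  by move=> h; rewrite -!subn1 leq_sub2r // h //; apply/subsetP=> x;
    rewrite inE => /andP[].
elim/last_ind: L hp hu => [|L p IH] //.
rewrite rcons_path /unzip2 map_rcons -rcons_cons rcons_uniq => /andP[hp hf]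
  /andP[np hu].
have {}IH := IH hp hu; rewrite -cats1 count_cat /= addn0.
set A := [set x in S | x \in _] in IH; set B := [set x in S | _].
have sAB : A \subset B.
  by apply/subsetP=> x; rewrite !in_set => /andP[-> h];
    rewrite -rcons_cons mem_rcons in_cons h orbT.
case: (boolP (_ && _)) => [/andP[p1 p2]|_]; last first.
  by rewrite addn0 (leq_trans IH) // -!subn1 leq_sub2r // subset_leq_card.
have p1A : p.1 \in A.
  rewrite in_set p1; move: hf; rewrite /follows !in_cons orbF.
  by have [h1 h2] := last_edge_order hp; case/orP=> /eqP->.
have : #|A| < #|B|.
  apply: proper_card; rewrite properE sAB; apply/subsetPn; exists p.2.
    by rewrite in_set p2 -rcons_cons mem_rcons mem_head.
  by rewrite in_set p2.
(* The predecessor is truncated at 0, so [A] must be nonempty for the bound to grow strictly from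
   [A] to [B]. *)
have : 0 < #|A| by apply/card_gt0P; exists p.1.
by move: IH; rewrite /A; lia.
Qed.

Lemma size_edge_order r L : edge_order r L ->
  (forall v, v \in r :: unzip2 L) -> size L = #|V|.-1.
Proof.
case=> _ hu _ hV; have /card_uniqP := hu.
by rewrite (eq_card (B := V)) ?cardT => [|x]; rewrite ?hV //= => ->;
  rewrite size_map.
Qed.

(** Double counting: every pair of [L] lies inside some [W i], and by [count_inside] each [W i]
    contains at most [(cover_cost W).-1] of them. *)
Lemma cover_lower_bound r L k (W : 'I_k -> {set V}) : edge_order r L ->
  is_cover e W -> size L <= k * (cover_cost W).-1.
Proof.
move=> oL cW; pose inside i p := (p.1 \in W i) && (p.2 \in W i).
apply: (@leq_trans (\sum_(i < k) count (inside i) L)).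
  under eq_bigr do rewrite -sum1_count big_mkcond /=.
  rewrite exchange_big /= -sum1_size [leqLHS]big_seq [leqRHS]big_seq.
  apply: leq_sum => p /(eo_edge oL)/cW [i hi].
  by rewrite (bigD1 i) //= /inside !(proj1 hi, proj2 hi).
apply: (@leq_trans (\sum_(i < k) (cover_cost W).-1)).
  apply: leq_sum => i _; apply: leq_trans (count_inside _ oL) _.
  by rewrite -!subn1 leq_sub2r // (leq_bigmax i).
by rewrite sum_nat_const card_ord.
Qed.

(** The numerical hypotheses say that [q] is the least number with [#|V|.-1 <= q * k]; [card_block]
    and [cover_lower_bound] then meet at [q.+1]. *)
Lemma block_optimal r L q k (W : 'I_k -> {set V}) :
  edge_order r L -> (forall v, v \in r :: unzip2 L) ->
  (forall x y, e x y -> ((x, y) \in L) || ((y, x) \in L)) ->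
  #|V|.-1 <= q * k -> (q = 0 \/ q.-1 * k < #|V|.-1) ->
  (forall i, W i = block q L i) -> optimal_cover e W.
Proof.
move=> oL hV hE; rewrite -(size_edge_order oL hV) => le_q lt_q hW; split.
  suff cov p : p \in L -> exists i, p.1 \in W i /\ p.2 \in W i.
    move=> x y /hE /orP[] /cov [i [/= hx hy]]; exists i; by split.
  move=> pL; have lt_j : index p L < size L by rewrite index_mem.
  have q0 : 0 < q by lia.
  have lt_k : index p L %/ q < k by rewrite ltn_divLR //; lia.
  have h := mem_chunk q0 pL; exists (Ordinal lt_k); rewrite !hW !inE !mem_cat.
  by rewrite (map_f fst h) (map_f snd h) orbT.
move=> W' cW'; have lb := cover_lower_bound oL cW'.
(* Without edges the optimum is 0, below the general bound [q.+1], and all blocks are empty. *)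
case: (posnP (size L)) => [/size0nil L0|L_gt0].
  suff -> : cover_cost W = 0 by [].
  apply/eqP; rewrite -leqn0; apply/bigmax_leqP => i _.
  rewrite leqn0 cards_eq0 hW; apply/eqP/setP=> x.
  by rewrite L0 /block /chunk !inE.
have ub : cover_cost W <= q.+1.
  apply/bigmax_leqP => i _; rewrite hW; apply: card_block.
  exact: path_sorted (eo_path oL).
apply: leq_trans ub _; have : (cover_cost W').-1 >= q; last first.
  by case: (cover_cost W') lb => [|c]; lia.
case: lt_q => [->//|lt_q].
rewrite leqNgt; apply/negP => h.
(* A cheaper cover would make [q.-1] large enough, against the minimality of [q]. *)
have : k * (cover_cost W').-1 <= q.-1 * k by rewrite mulnC leq_mul2r; lia.
by lia.
Qed.

End EdgeOrders.

(** * Spines of caterpillars *)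

Section Spines.

Variables (V : finType) (e : rel V).

Lemma degree1_inj v x y : degree e v = 1 -> e v x -> e v y -> x = y.
Proof.
move/eqP/cards1P=> [z hz] ex ey.
have : x \in [set y | e v y] by rewrite inE.
have : y \in [set y | e v y] by rewrite inE.
by rewrite hz !inE => /eqP-> /eqP->.
Qed.

Lemma degree_gt0 v : connected_graph e -> 1 < #|V| -> 0 < degree e v.
Proof.
move=> ce gt1; have : 0 < #|[set~ v]| by rewrite cardsC1 -ltnS prednK // ltnW.
case/card_gt0P=> w; rewrite !inE => nwv.
have /connectP[[|u p] /=] := ce v w; first by move=> _ eq_wv;
  rewrite eq_wv eqxx in nwv.
by case/andP=> evu _ _; apply/card_gt0P; exists u; rewrite inE.
Qed.

(** The pair [x], [y] is closed under adjacency, so connectedness makes it the whole graph. *)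
Lemma two_adjacent_leaves x y z : simple_graph e -> connected_graph e ->
  degree e x = 1 -> degree e y = 1 -> e x y -> z \in [:: x; y].
Proof.
case=> sym _ ce dx dy exy; rewrite -(@closed_connect _ e (mem [:: x;
  y]) _ x z) //.
  by rewrite !inE eqxx.
have step u v : e u v -> u \in [:: x; y] -> v \in [:: x; y].
  rewrite !inE => euv /orP[/eqP eu|/eqP eu]; rewrite eu in euv.
    by rewrite (degree1_inj dx euv exy) eqxx orbT.
  by rewrite sym in exy; rewrite (degree1_inj dy euv exy) eqxx.
by move=> u v euv; apply/idP/idP; apply: step; rewrite // sym.
Qed.

(* A single edge rx has the spine r here, although both its ends are leaves;
   this is why the condition on degrees spares r. *)
Record is_spine (r : V) (sp : seq V) : Prop := IsSpine {
  spine_uniq : uniq sp;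
  spine_size : 0 < size sp;
  spine_head : nth r sp 0 = r;
  spine_edge : forall i j, i < size sp -> j < size sp ->
    e (nth r sp i) (nth r sp j) = (i.+1 == j) || (j.+1 == i);
  spine_leaf : forall v, v \notin sp ->
    degree e v = 1 /\ exists2 u, u \in sp & e u v;
  spine_inner : forall v, v \in sp -> v != r -> degree e v != 1
}.

Lemma is_spine_seq1 r : simple_graph e ->
  (forall v, v != r -> degree e v = 1 /\ e r v) -> is_spine r [:: r].
Proof.
case=> _ irr h; split=> //.
- by case=> [|i] [|j] //= _ _; rewrite irr.
- by move=> v; rewrite inE => /h [dv erv]; split=> //; exists r; rewrite ?inE.
by move=> v; rewrite inE => ->.
Qed.

(** A vertex off the path is a leaf. Its neighbour is not one, since two adjacent leaves would be
    the whole graph and exclude the non-leaf [f i0]. *)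
Lemma is_spine_path m (f : 'I_m -> V) (i0 : 'I_m) :
  simple_graph e -> connected_graph e -> 1 < #|V| ->
  injective f -> ~: leaves e = [set f i | i in 'I_m] ->
  (forall i j : 'I_m, e (f i) (f j) = (i.+1 == j) || (j.+1 == i)) ->
  i0 = 0 :> nat -> is_spine (f i0) (map f (enum 'I_m)).
Proof.
move=> sg ce gt1 inj_f im_f adj_f i00.
have mem_sp v : (v \in map f (enum 'I_m)) = (degree e v != 1).
  have := in_setC v (leaves e); rewrite im_f inE => <-.
  by apply/mapP/imsetP=> -[i _ ->]; exists i; rewrite ?mem_enum.
have nth_sp i (lt_i : i < m) : nth (f i0) (map f (enum 'I_m)) i = f (Ordinal
  lt_i).
  by rewrite (nth_map i0) ?size_enum_ord //; congr f; apply: val_inj;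
    rewrite /= nth_enum_ord.
have di0 : degree e (f i0) != 1 by rewrite -mem_sp map_f ?mem_enum.
split.
- by rewrite map_inj_uniq ?enum_uniq.
- by rewrite size_map size_enum_ord -i00.
- by rewrite -i00 nth_sp; congr f; apply: val_inj.
- by move=> i j; rewrite size_map size_enum_ord => hi hj; rewrite !nth_sp adj_f.
- move=> v; rewrite mem_sp negbK => /eqP dv; split=> //.
  have /card_gt0P[u] := degree_gt0 v ce gt1; rewrite inE => evu.
  exists u; last by rewrite (proj1 sg).
  rewrite mem_sp; apply/eqP => du.
  have := two_adjacent_leaves (f i0) sg ce dv du evu.
  by rewrite !inE => /orP[] /eqP E; rewrite E ?dv ?du in di0.
by move=> v; rewrite mem_sp.
Qed.

(** In a connected graph on several vertices the non-leaves are the vertices of degree above 1, so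
    degrees alone detect an end of the path they induce, a one-vertex path included. *)
Definition inner_end v :=
  (1 < degree e v) && (#|[set w | e v w & 1 < degree e w]| < 2).

(** The disjunction is what the root search delivers. An inner end starts the path, possibly
    reversed; without any inner end the tree is a single vertex or a single edge. *)
Lemma caterpillar_spine r : caterpillar e ->
  inner_end r \/ (forall v, ~~ inner_end v) -> exists sp, is_spine r sp.
Proof.
case=> -[sg V0 ce _] [m [f [inj_f im_f adj_f]]] end_r.
have [gt1|le1] := ltnP 1 #|V|; last first.
  exists [:: r]; apply: is_spine_seq1 => // v nvr.
  suff : 1 < #|V| by rewrite ltnNge le1.
  by apply: leq_trans _ (max_card (pred2 v r)); rewrite card2 nvr.
have mem_f v : (v \in [set f i | i in 'I_m]) = (1 < degree e v).
  rewrite -im_f !inE; have := degree_gt0 v ce gt1;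
    case: (degree e v) => [|[]] //.
case: end_r => [end_r|no_end].
  have /andP[dr cr] := end_r; rewrite -mem_f in dr.
  have [i _ ri] := imsetP dr; rewrite ri in cr *.
  have [i0|i_gt0] := posnP i.
    by exists (map f (enum 'I_m)); apply: is_spine_path.
  have [lt_im|ge_im] := ltnP i.+1 m; last first.
    pose g := f \o @rev_ord m;
      have gi : g (rev_ord i) = f i by rewrite /g /= rev_ordK.
    exists (map g (enum 'I_m)); rewrite -gi; apply: is_spine_path => //.
    - exact: inj_comp inj_f rev_ord_inj.
    - rewrite im_f; apply/setP=> v; apply/imsetP/imsetP=> -[j _ ->].
        by exists (rev_ord j); rewrite // /g /= rev_ordK.
      by exists (rev_ord j).
    - move=> j j'; rewrite adj_f /=; have := ltn_ord j; have := ltn_ord j'; lia.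
    rewrite /=; have := ltn_ord i; lia.
  (* An interior vertex of the path has two neighbours of degree above 1, against [inner_end]. *)
  have lt_pm : i.-1 < m by have := ltn_ord i; lia.
  suff : 1 < #|[set w | e (f i) w & 1 < degree e w]| by rewrite ltnNge -ltnS cr.
  pose a := f (Ordinal lt_pm); pose b := f (Ordinal lt_im).
  have nab : a != b by rewrite (inj_eq inj_f) -val_eqE /=; lia.
  apply/card_gt1P; exists a, b; split=> //;
    rewrite inE -mem_f adj_f imset_f //=; lia.
(* Otherwise the first vertex of the path would be an inner end. *)
have m0 : m = 0.
  case: m f inj_f im_f adj_f mem_f => // m f inj_f im_f adj_f mem_f.
  have := no_end (f ord0); rewrite /inner_end -mem_f imset_f //= -leqNgt.
  case/card_gt1P=> x [y [hx hy]]; rewrite !inE -!mem_f in hx hy.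
  case/andP: hx => ex /imsetP[i _ xi]; case/andP: hy => ey /imsetP[j _ yj].
  move: ex ey; rewrite xi yj !adj_f /= (inj_eq inj_f) -val_eqE /=; lia.
have leaf v : degree e v = 1.
  apply/eqP/negPn/negP=> h; have : v \in ~: leaves e by rewrite !inE.
  by rewrite im_f => /imsetP[i]; have := ltn_ord i; rewrite {2}m0.
exists [:: r]; apply: is_spine_seq1 => // v nvr; split=> //.
have /card_gt0P[u] := degree_gt0 v ce gt1; rewrite inE => evu.
have := two_adjacent_leaves r sg ce (leaf v) (leaf u) evu.
by rewrite !inE eq_sym (negPf nvr) /= => /eqP ->; rewrite (proj1 sg).
Qed.

(** Off the spine, [index] takes the value [size sp], after all spine vertices. A vertex has at most
    one neighbour of smaller index, so the pair of [L] whose child is the later end of an edge is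
    that edge. *)
Lemma spine_order_complete r sp L : simple_graph e -> is_spine r sp ->
  (forall p, p \in L -> e p.1 p.2) -> (forall v, v \in r :: unzip2 L) ->
  (forall p, p \in L -> index p.1 sp < index p.2 sp) ->
  forall x y, e x y -> ((x, y) \in L) || ((y, x) \in L).
Proof.
move=> [sym irr] S eL hV iL x y exy.
wlog le_xy : x y exy / index x sp <= index y sp.
  move=> H; have [/H|/ltnW/H] := leqP (index x sp) (index y sp); first exact.
  by rewrite orbC; apply; rewrite sym.
(* An edge cannot have both ends off the spine: the only neighbour of such a vertex is on it. *)
have [px|nx] := boolP (x \in sp); last first.
  have ny : y \notin sp by move: le_xy nx; rewrite -!index_mem; lia.
  have [dx [u us eux]] := spine_leaf S nx; rewrite sym in eux.
  by rewrite (degree1_inj dx exy eux) us in ny.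
have nyr : y != r.
  apply: contraTneq le_xy => yr; rewrite -ltnNge.
  have ir : index r sp = 0.
    by rewrite -{1}(spine_head S) index_uniq ?(spine_size S) ?(spine_uniq S).
  rewrite yr ir lt0n; apply/eqP => ix; have := nth_index r px.
  by rewrite ix (spine_head S) => rx; rewrite yr rx irr in exy.
have := hV y; rewrite inE (negPf nyr) /= => /mapP[[p y'] pL /= eqy].
rewrite -{}eqy in pL; have /= epy := eL _ pL; have /= ipy := iL _ pL.
suff <- : p = x by rewrite pL.
have [py|ny] := boolP (y \in sp); last first.
  by have [dy _] := spine_leaf S ny; apply: (degree1_inj dy); rewrite sym.
have pp : p \in sp by rewrite -index_mem (ltn_trans ipy) ?index_mem.
have adj a : a \in sp -> e a y -> index a sp <= index y sp ->
  (index a sp).+1 = index y sp.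
  move=> ha; rewrite -{1}(nth_index r ha) -{1}(nth_index r py) (spine_edge S)
    ?index_mem //.
  by lia.
have := adj p pp epy (ltnW ipy); rewrite -(adj x px exy le_xy) => -[eq_i].
by rewrite -(nth_index r pp) eq_i nth_index.
Qed.

End Spines.

(** * The program *)

Local Notation vN := 0.
Local Notation vK := 1.
Local Notation vI := 2.
Local Notation vJ := 3.
Local Notation vZ := 4.
Local Notation vRow := 5.
Local Notation vAcc := 6.
Local Notation vRoot := 7.
Local Notation vQ := 8.
Local Notation vCur := 9.
Local Notation vNext := 10.
Local Notation vBase := 11.
Local Notation vCount := 12.
Local Notation aAdj := 0.
Local Notation aOut := 1.
Local Notation aDeg := 2.
Local Notation aSeen := 3.

(** The machine has no multiplication: the offset of a matrix row is computed as an [n]-fold sum. *)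
Definition row (x : nat) : prog := Sum vZ vRow (Var x).

Definition adjacent : expr := Get aAdj (Add (Var vRow) (Var vJ)).

Definition degrees : prog :=
  PFor vI (PSeq (row vI) (PSeq (Sum vJ vAcc adjacent)
    (PPut aDeg (Var vI) (Var vAcc)))).

(* For an edge ij, the summand is 1 if the degree of j exceeds 1, else 0. *)
Definition root_step : prog :=
  PSeq (row vI)
    (PSeq
      (Sum vJ vAcc (Defs.Sub adjacent (Defs.Sub (Cst 2) (Get aDeg (Var vJ)))))
      (PIf (Defs.Sub (Get aDeg (Var vI)) (Cst 1))
        (PIf (Defs.Sub (Cst 2) (Var vAcc)) (PAssign vRoot (Var vI)) PSkip)
        PSkip)).

(** If no vertex passes the test, the root stays at vertex 0, and by [caterpillar_spine] any vertex
    is then suitable. *)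
Definition find_root : prog :=
  PSeq (PAssign vRoot (Cst 0)) (PFor vI root_step).

Definition capacity_step : prog :=
  PIf (Defs.Sub (Defs.Sub (Var vN) (Cst 1)) (Var vAcc))
    (PSeq (PAssign vAcc (Add (Var vAcc) (Var vK)))
          (PAssign vQ (Add (Var vQ) (Cst 1))))
    PSkip.

(* vQ becomes the least q with n - 1 <= q * k, and vAcc the product q * k. *)
Definition capacity : prog :=
  PSeq (PAssign vAcc (Cst 0))
    (PSeq (PAssign vQ (Cst 0)) (PFor vJ capacity_step)).

(** * Correctness of the degree table, the root search and the capacity *)

Section Correctness.

Variables (n k : nat) (e : rel 'I_n).

Record has_graph (s : state) : Prop := HasGraph {
  has_n : var s vN = n;
  has_adj : forall i j : 'I_n, arr s aAdj (i * n + j) = e i j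
}.

Record has_degrees (s : state) : Prop := HasDegrees {
  has_deg : forall i : 'I_n, arr s aDeg i = degree e i
}.

Lemma agree_graph p s s1 : vN \notin assigned p -> aAdj \notin written p ->
  agree p s s1 -> has_graph s -> has_graph s1.
Proof. by move=> h0 h1 [hv ha] [hn hadj]; split; rewrite ?hv ?ha. Qed.

Lemma agree_degrees p s s1 : aDeg \notin written p ->
  agree p s s1 -> has_degrees s -> has_degrees s1.
Proof. by move=> h1 [_ ha] [hd]; split; rewrite ha. Qed.

Lemma agree_run p s : agree p s (run p s).
Proof. by split=> *; [exact: run_var|exact: run_arr]. Qed.

Lemma row_eq x s : has_graph s -> x != vZ -> x != vRow ->
  var (run (row x) s) vRow = var s x * n.
Proof.
move=> G xz xr; rewrite (run_sum (n := n) (F := fun=> var s x)) //.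
- by rewrite sum_nat_const card_ord mulnC.
- exact: has_n.
by move=> j s1 [hv _] _; rewrite /= hv //= !inE !negb_or xr xz.
Qed.

Lemma degree_sum (i : 'I_n) : degree e i = \sum_(j < n) e i j.
Proof.
rewrite /degree -sum1_card big_mkcond /=; apply: eq_bigr => j _.
by rewrite inE; case: (e i j).
Qed.

Lemma run_degrees s : has_graph s -> has_degrees (run degrees s).
Proof.
move=> G; suff H (i : 'I_n) : i < var s vN ->
  arr (run degrees s) aDeg i = degree e i.
  by split=> i; apply: H; rewrite (has_n G).
move: i.
apply: (run_for (I := fun j s1 => forall i : 'I_n, i < j ->
  arr s1 aDeg i = degree e i)) => //.
move=> m s1; rewrite (has_n G) => lt_m hs hm IH i.
have G1 : has_graph s1 by apply: agree_graph hs G.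
rewrite run_seq; set s2 := run (row vI) s1.
have G2 : has_graph s2 by apply: agree_graph (agree_run _ _) G1.
have row2 : var s2 vRow = m * n by rewrite row_eq // hm.
rewrite run_seq; set s3 := run (Sum _ _ _) s2.
have acc3 : var s3 vAcc = degree e (Ordinal lt_m).
  rewrite degree_sum; apply: run_sum (has_n G2) _ => // j s4 h4 hj.
  have G4 : has_graph s4 by apply: agree_graph h4 G2.
  by rewrite /= (proj1 h4) // hj row2 -(has_adj G4).
have i3 : var s3 vI = m by rewrite run_var // run_var.
have d3 : arr s3 aDeg = arr s1 aDeg by rewrite run_arr // run_arr.
rewrite runE /= acc3 i3 d3.
rewrite ltnS leq_eqVlt; case: (eqVneq (i : nat) m) => [eq_i _|_ /IH //].
by congr degree; apply: val_inj.
Qed.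

Lemma run_find_root s : 0 < n -> has_graph s -> has_degrees s ->
  exists2 r : 'I_n, var (run find_root s) vRoot = r
    & inner_end e r \/ forall v, ~~ inner_end e v.
Proof.
move=> n0 G D; rewrite run_seq run_assign; set s0 := set_var _ _ _.
have G0 : has_graph s0 by case: G.
have D0 : has_degrees s0 by case: D.
suff [r hr [er|nr]] : exists2 r : 'I_n,
  var (run (PFor vI root_step) s0) vRoot = r
    & inner_end e r \/ forall v : 'I_n, v < var s0 vN -> ~~ inner_end e v.
- by exists r; [exact: hr|left].
- by exists r; [exact: hr|right=> v; apply: nr; rewrite (has_n G0)].
apply: (run_for (I := fun j s1 => exists2 r : 'I_n, var s1 vRoot = r
    & inner_end e r \/ forall v : 'I_n, v < j -> ~~ inner_end e v)) => //.
  by exists (Ordinal n0); last right.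
move=> m s1; rewrite (has_n G0) => lt_m hs hm [r hr IH]; pose i := Ordinal lt_m.
have G1 : has_graph s1 by apply: agree_graph hs G0.
have D1 : has_degrees s1 by apply: agree_degrees hs D0.
rewrite run_seq; set s2 := run (row vI) s1.
have G2 : has_graph s2 by apply: agree_graph (agree_run _ _) G1.
have D2 : has_degrees s2 by apply: agree_degrees (agree_run _ _) D1.
have row2 : var s2 vRow = m * n by rewrite row_eq // hm.
rewrite run_seq; set s3 := run (Sum _ _ _) s2.
have D3 : has_degrees s3 by apply: agree_degrees (agree_run _ _) D2.
have acc3 : var s3 vAcc = #|[set w | e i w & 1 < degree e w]|.
  rewrite -sum1_card big_mkcond /=;
    apply: run_sum (has_n G2) _ => // j s4 h4 hj.
  have G4 : has_graph s4 by apply: agree_graph h4 G2.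
  have D4 : has_degrees s4 by apply: agree_degrees h4 D2.
  rewrite /= (proj1 h4) // hj row2 -[m]/(val i) (has_adj G4) (has_deg D4) inE.
  by case: (e i j); case: ltnP => /=; lia.
have i3 : var s3 vI = m by rewrite run_var // run_var.
have r3 : var s3 vRoot = r by rewrite run_var // run_var.
have next : inner_end e r \/ (forall v : 'I_n, v < m.+1 ->
  ~~ inner_end e v) \/ inner_end e i.
  case: IH => [|IH]; first by left.
  case: (boolP (inner_end e i)) => [|ni]; [by right; right|right; left=> v].
  rewrite ltnS leq_eqVlt => /predU1P[eq_v|/IH //].
  by rewrite (_ : v = i) //; apply: val_inj.
have test : ((1 < degree e i) && (var s3 vAcc < 2)) = inner_end e i by rewrite
  acc3.
rewrite !runE /= i3 -[m]/(val i) (has_deg D3).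
move: next; rewrite -test; case: ltnP => h1 /=; last first.
  rewrite (_ : degree e i - 1 = 0) /= ?r3; last by lia.
  by case=> [|[]] //; exists r => //; tauto.
rewrite (_ : degree e i - 1 != 0); last by lia.
case: ltnP => h2 /=; last first.
  rewrite (_ : 2 - var s3 vAcc = 0) /= ?r3; last by lia.
  by case=> [|[]] //; exists r => //; tauto.
rewrite (_ : 2 - var s3 vAcc != 0) /= ?eqxx; last by lia.
by move=> _; exists i => //; left; rewrite -test h1.
Qed.

Lemma run_capacity s : 0 < k -> var s vN = n -> var s vK = k ->
  let q := var (run capacity s) vQ in
  n.-1 <= q * k /\ (q = 0 \/ q.-1 * k < n.-1).
Proof.
move=> k0 hn hk; rewrite /capacity run_seq run_seq !run_assign.
set s0 := set_var _ vQ _; have hn0 : var s0 vN = n by [].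
have hk0 : var s0 vK = k by [].
suff [h1 h2 h3] : let s1 := run (PFor vJ capacity_step) s0 in
  [/\ var s1 vAcc = var s1 vQ * k, var s1 vQ = 0 \/ (var s1 vQ).-1 * k < n.-1
    & n <= var s1 vAcc \/ n.-1 <= var s1 vAcc].
  split; last exact: h2.
  by rewrite -h1; case: h3 => //; exact/leq_trans/leq_pred.
rewrite /= -{2}hn0.
(* While [vAcc] is below [n.-1], each pass adds [k], at least 1, to it; hence the clause with [j],
   which shows that [n] passes suffice. *)
apply: (run_for (I := fun j s1 => [/\ var s1 vAcc = var s1 vQ * k,
    var s1 vQ = 0 \/ (var s1 vQ).-1 * k < n.-1
    & j <= var s1 vAcc \/ n.-1 <= var s1 vAcc])) => //.
  by split=> //; left.
move=> m s1 lt_m [hv _] hm [h1 h2 h3].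
have hn1 : var s1 vN = n by rewrite hv.
have hk1 : var s1 vK = k by rewrite hv.
rewrite !runE /= hn1 hk1; case: eqP => [h|h] /=; first by split=> //; right;
  lia.
by rewrite mulnDl mul1n addn1 /= h1; split=> //; [right|left]; lia.
Qed.

End Correctness.

(** * The walk along the spine *)

(** [vBase] is the offset of the current output row and [vCount] the number of pairs in its block:
    they track quotient and remainder by [q] without division. *)
Definition emit : prog :=
  PSeq (PPut aSeen (Var vJ) (Cst 1))
 (PSeq (PPut aOut (Add (Var vBase) (Var vCur)) (Cst 1))
 (PSeq (PPut aOut (Add (Var vBase) (Var vJ)) (Cst 1))
 (PSeq (PAssign vCount (Add (Var vCount) (Cst 1)))
       (PIf (Defs.Sub (Var vQ) (Var vCount)) PSkip
         (PSeq (PAssign vBase (Add (Var vBase) (Var vN)))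
               (PAssign vCount (Cst 0))))))).

(** The [aSeen] test makes repeated passes at the last spine vertex idle. *)
Definition leaf_step : prog :=
  PIf adjacent
    (PIf (Defs.Sub (Get aDeg (Var vJ)) (Cst 1)) PSkip
      (PIf (Get aSeen (Var vJ)) PSkip emit))
    PSkip.

(** The leaves at [vCur] have all been seen by now, so an unseen neighbour is the next spine vertex.
    The move is deferred through [vNext] because the rest of the scan still concerns [vCur]. *)
Definition spine_step : prog :=
  PIf adjacent
    (PIf (Get aSeen (Var vJ)) PSkip (PSeq emit (PAssign vNext (Var vJ))))
    PSkip.

Definition walk_step : prog :=
  PSeq (row vCur)
 (PSeq (PFor vJ leaf_step)
 (PSeq (PAssign vNext (Var vCur))
 (PSeq (PFor vJ spine_step)
       (PAssign vCur (Var vNext))))).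

Definition walk : prog :=
  PSeq (PAssign vCur (Var vRoot))
 (PSeq (PPut aSeen (Var vRoot) (Cst 1))
       (PFor vI walk_step)).

(** * The walk produces a complete edge order and its blocks *)

Section Walk.

Variables (n : nat) (e : rel 'I_n) (r : 'I_n) (sp : seq 'I_n) (q : nat).
Hypotheses (sg : simple_graph e) (spP : is_spine e r sp).
Hypothesis q_gt0 : forall u w, e u w -> 0 < q.

Local Notation order L := (r :: unzip2 L).

(** [b] is the index of the current spine vertex, and the leaves at the first [m] spine vertices are
    done. [m] may exceed [size sp], when the walk idles at the end. *)
Record progress (L : seq ('I_n * 'I_n)) (b m : nat) : Prop := Progress {
  pr_order : edge_order e r L;
  pr_index : forall p, p \in L -> index p.1 sp < index p.2 sp;
  pr_last : nth r sp b \in [:: (last (r, r) L).1; (last (r, r) L).2];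
  pr_old : forall i, i <= b -> nth r sp i \in order L;
  pr_new : forall i, b < i < size sp -> nth r sp i \notin order L;
  pr_leaf : forall v i, v \notin sp -> i < m -> i < size sp ->
    e (nth r sp i) v -> v \in order L
}.

Lemma progress_nil : progress [::] 0 0.
Proof.
split=> //.
- by rewrite (spine_head spP) mem_head.
- by case=> // _; rewrite (spine_head spP) mem_head.
move=> i /andP[i0 lt_i]; rewrite inE -{2}(spine_head spP).
by rewrite nth_uniq ?(spine_uniq spP) ?(spine_size spP) // -lt0n.
Qed.

Lemma mem_order_rcons (L : seq ('I_n * 'I_n)) p v : (v \in order (rcons L p))
  = (v == p.2) || (v \in order L).
Proof. by rewrite /unzip2 map_rcons -rcons_cons mem_rcons in_cons. Qed.

Lemma progress_leaf L b m v : progress L b m -> b < size sp -> v \notin sp ->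
  e (nth r sp b) v -> v \notin order L ->
    progress (rcons L (nth r sp b, v)) b m.
Proof.
case=> oL iL lL old new leaf lt_b nv ev nvL; split.
- exact: edge_order_rcons.
- move=> p; rewrite mem_rcons inE => /predU1P[->|/iL //] /=.
  by rewrite index_uniq ?(spine_uniq spP) // (memNindex nv).
- by rewrite last_rcons mem_head.
- by move=> i /old h; rewrite mem_order_rcons h orbT.
- move=> i hi; rewrite mem_order_rcons negb_or (new i hi) andbT.
  by apply: contraNneq nv => /= <-; rewrite mem_nth //; case/andP: hi.
by move=> w i h1 h2 h3 h4; rewrite mem_order_rcons (leaf w i) // orbT.
Qed.

Lemma progress_spine L b m : progress L b m -> b.+1 < size sp ->
  progress (rcons L (nth r sp b, nth r sp b.+1)) b.+1 m.
Proof.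
case=> oL iL lL old new leaf lt_b; split.
- apply: edge_order_rcons => //; first by apply: new; rewrite ltnS leqnn.
  by rewrite (spine_edge spP) ?eqxx // ltnW.
- move=> p; rewrite mem_rcons inE => /predU1P[->|/iL //] /=.
  by rewrite !index_uniq ?(spine_uniq spP) // ltnW.
- by rewrite last_rcons !inE eqxx orbT.
- move=> i; rewrite leq_eqVlt mem_order_rcons => /predU1P[->|];
  first by rewrite eqxx.
  by rewrite ltnS => /old ->; rewrite orbT.
- move=> i /andP[lt_i lt_s];
  rewrite mem_order_rcons negb_or new ?lt_s ?andbT ?(ltnW lt_i) //.
  by rewrite nth_uniq ?(spine_uniq spP) // neq_ltn lt_i orbT.
by move=> w i h1 h2 h3 h4; rewrite mem_order_rcons (leaf w i) // orbT.
Qed.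

(** Once [m] is past the spine, the new instance of [pr_leaf] is vacuous; this is why [b = m] is
    asked only before that. *)
Lemma progress_next L b m : progress L b m -> (m < size sp -> b = m) ->
  (forall v, v \notin sp -> e (nth r sp b) v -> v \in order L) ->
    progress L b m.+1.
Proof.
case=> oL iL lL old new leaf bm done; split=> // v i nv.
rewrite ltnS leq_eqVlt => /predU1P[->|lt_i] lt_s ev; last exact: (leaf v i).
by apply: done; rewrite ?bm.
Qed.

(** Leaves at [b] are done since [b < m]; a spine neighbour has index [b.-1] or [b.+1], and every
    index up to [c] is seen. *)
Lemma unseen_neighbour L b c m w : progress L c m -> b < m -> b <= c ->
  b < size sp -> e (nth r sp b) w -> w \notin order L ->
  [/\ w = nth r sp b.+1, b.+1 < size sp & b = c].
Proof.
move=> P bm bc lt_b ew nw; have [ws|ws] := boolP (w \in sp); last first.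
  by rewrite (pr_leaf P ws bm) in nw.
have lt_i : index w sp < size sp by rewrite index_mem.
have ew' := ew; rewrite -(nth_index r ws) in ew' nw *.
rewrite (spine_edge spP) // in ew'.
have lt_ci : c < index w sp by rewrite ltnNge; apply: contra nw => /(pr_old P).
have eq_i : index w sp = b.+1 by lia.
by rewrite -eq_i; split=> //; lia.
Qed.

(** * Machine states along the walk *)

Record env (s : state) : Prop := Env {
  env_graph : has_graph e s;
  env_degrees : has_degrees e s;
  env_q : var s vQ = q
}.

Lemma agree_env p s s1 : [&& vN \notin assigned p, vQ \notin assigned p,
  aAdj \notin written p & aDeg \notin written p] ->
  agree p s s1 -> env s -> env s1.
Proof.
case/and4P=> h1 h2 h3 h4 h [G D Q]; split.
- exact: agree_graph h G.
- exact: agree_degrees h D.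
by rewrite (proj1 h).
Qed.

(** [L] is a ghost list: memory holds only its vertices, its blocks and its size divided by [q]. *)
Record traced (L : seq ('I_n * 'I_n)) (s : state) : Prop := Traced {
  tr_seen : forall w : 'I_n, (arr s aSeen w != 0) = (w \in order L);
  tr_out : forall i (x : 'I_n),
    (arr s aOut (i * n + x) != 0) = (x \in block q L i);
  tr_base : var s vBase = (size L %/ q) * n;
  tr_count : var s vCount = size L %% q
}.

Lemma agree_traced p s s1 L : [&& vBase \notin assigned p,
  vCount \notin assigned p,
  aOut \notin written p & aSeen \notin written p] ->
  agree p s s1 -> traced L s -> traced L s1.
Proof.
case/and4P=> h1 h2 h3 h4 [hv ha] [T1 T2 T3 T4].
by split=> *; rewrite ?ha ?hv.
Qed.

Lemma cell_eq i b (x u : 'I_n) : (i * n + x == b * n + u) = (i == b) && (x ==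
  u).
Proof.
have n0 : 0 < n by case: (n) x => [[]|].
apply/eqP/andP=> [E|[/eqP-> /eqP->] //].
have := congr1 (divn^~ n) E; have := congr1 (modn^~ n) E.
by rewrite !modnMDl !divnMDl // !modn_small // !divn_small // !addn0 =>
  /val_inj-> ->.
Qed.

Lemma block_rcons (L : seq ('I_n * 'I_n)) u w i x : 0 < q ->
  (x \in block q (rcons L (u, w)) i) =
  (x \in block q L i) || ((i == size L %/ q) && (x \in [:: u; w])).
Proof.
move=> q0; rewrite !in_set chunk_rcons //; case: (i == _); last by rewrite orbF.
rewrite /unzip1 /unzip2 !map_rcons !mem_cat !mem_rcons !inE /=.
by case: (x == u); case: (x == w); rewrite ?orbT ?orbF.
Qed.

Lemma run_emit L s (u w : 'I_n) : 0 < q -> env s -> var s vCur = u ->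
  var s vJ = w -> traced L s -> traced (rcons L (u, w)) (run emit s).
Proof.
move=> q0 [[hn _] _ hq] hu hw [T1 T2 T3 T4].
have dm := divn_eq (size L) q; have lm := ltn_pmod (size L) q0.
(* Successor with carry, matching the final test of [emit]. *)
have dmS : (size L).+1 %/ q = size L %/ q + ((size L %% q).+1 == q)
    /\ (size L).+1 %% q = if (size L %% q).+1 == q then 0 else (size L %% q).+1.
  case: eqP => h.
    have -> : (size L).+1 = (size L %/ q + 1) * q by rewrite mulnDl mul1n
      {1}dm -addnS h.
    by rewrite mulnK // modnMl.
  have -> : (size L).+1 = (size L %/ q) * q + (size L %% q).+1 by rewrite
    addnS -dm.
  have lt_q : (size L %% q).+1 < q by rewrite ltn_neqAle lm andbT; exact/eqP.
  by rewrite divnMDl // modnMDl (divn_small lt_q) (modn_small lt_q).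
rewrite !runE /=; set s' := (if _ then _ else _).
(* The final test changes variables only, so both outcomes have the same arrays. *)
have arr' a p : arr s' a p =
    if (a == aOut) && ((p == var s vBase + w) || (p == var s vBase + u)) then 1
    else if (a == aSeen) && (p == w) then 1 else arr s a p.
  rewrite /s' -hu -hw; case: (_ != _) => /=.
    by case: (a == aOut); case: (p == _ + var s vJ);
      case: (p == _ + var s vCur).
  by case: (a == aOut); case: (p == _ + var s vJ); case: (p == _ + var s vCur).
split.
- move=> x; rewrite arr' mem_order_rcons /= val_eqE -T1; by case: (x == w).
- move=> i x; rewrite arr' block_rcons //= T3 !cell_eq -T2 !inE.
  by case: (i == _); case: (x == u); case: (x == w); rewrite /= ?orbT ?orbF.
- rewrite size_rcons (proj1 dmS) /s' hq T4 addn1.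
  have [->|h] := eqVneq (size L %% q).+1 q;
    first by rewrite subnn /= T3 hn mulnDl mul1n.
  by rewrite (_ : _ - _ != 0) /= ?T3 ?addn0 //; lia.
rewrite size_rcons (proj2 dmS) /s' hq T4 addn1.
have [->|h] := eqVneq (size L %% q).+1 q; first by rewrite subnn.
by rewrite (_ : _ - _ != 0) /= ?T4 ?addn1 //; lia.
Qed.

Lemma traced_set_var L s x v : x != vBase -> x != vCount ->
  traced L s -> traced L (set_var s x v).
Proof.
move=> xb xc [T1 T2 T3 T4].
by split=> //=; rewrite eq_sym ?(negPf xb) ?(negPf xc).
Qed.

Lemma eval_adjacent s (u w : 'I_n) : env s -> var s vRow = u * n ->
  var s vJ = w -> eval s adjacent = e u w.
Proof. by move=> [G _ _] hr hj; rewrite /= hr hj (has_adj G). Qed.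

Lemma run_leaf_loop L s b m :
  env s -> traced L s -> progress L b m -> b < size sp ->
  var s vCur = nth r sp b -> var s vRow = nth r sp b * n ->
  exists L', [/\ traced L' (run (PFor vJ leaf_step) s), progress L' b m
    & forall v, v \notin sp -> e (nth r sp b) v -> v \in order L'].
Proof.
move=> E T P lt_b hc hr; have hn := has_n (env_graph E).
suff [L' [T' P' H']] : exists L',
    [/\ traced L' (run (PFor vJ leaf_step) s), progress L' b m
      & forall v : 'I_n, v < var s vN -> v \notin sp -> e (nth r sp b) v ->
        v \in order L'].
  by exists L'; split=> // v; apply: H'; rewrite hn.
apply: (run_for (I := fun j s1 => exists L', [/\ traced L' s1, progress L' b m
  & forall v : 'I_n, v < j -> v \notin sp -> e (nth r sp b) v ->
    v \in order L'])) => //.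
  by exists L; split=> //; exact: traced_set_var.
move=> j s1; rewrite hn => lt_j hs hj [{T P}L' [T P done]].
have E1 : env s1 by apply: agree_env hs E.
set u := nth r sp b in hc hr done *; pose w := Ordinal lt_j.
have hc1 : var s1 vCur = u by rewrite (proj1 hs).
have hr1 : var s1 vRow = u * n by rewrite (proj1 hs).
have upto L1 : {subset order L' <= order L1} ->
    (w \notin sp -> e u w -> w \in order L1) ->
    forall v : 'I_n, v < j.+1 -> v \notin sp -> e u v -> v \in order L1.
  move=> sub hw v; rewrite ltnS leq_eqVlt => /predU1P[eq_v|lt_v] nv ev.
    by rewrite (_ : v = w) in nv ev *; [exact: hw|exact: val_inj].
  exact/sub/done.
have same : (w \notin sp -> e u w -> w \in order L') ->
    exists L1, [/\ traced L1 (set_var s1 vJ j.+1), progress L1 b m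
      & forall v : 'I_n, v < j.+1 -> v \notin sp -> e u v -> v \in order L1].
  by move=> hw; exists L'; split=> //; [exact: traced_set_var|exact: upto].
rewrite run_if (eval_adjacent E1 hr1 (w := w)) //.
case euw: (e u w); rewrite /= ?run_skip; last by apply: same => _; rewrite euw.
have dw : 0 < degree e w.
  by apply/card_gt0P; exists u; rewrite inE (proj1 sg).
rewrite run_if /= hj -[j in arr _ _ j]/(val w) (has_deg (env_degrees E1)).
case: eqP => [d1|d2] /=; last first.
  rewrite run_skip; apply: same => nw; case: (spine_leaf spP nw) => d1.
  by rewrite d1 in d2.
rewrite run_if /= hj -[j in arr _ _ j]/(val w) (tr_seen T).
case: ifPn => [seen|unseen]; first by rewrite run_skip; exact: same.
(* The only spine vertex that may have degree 1 is [r], which is seen from the start. *)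
have nw : w \notin sp.
  apply: contraNN unseen => ws; case: (eqVneq w r) => [->|nwr];
    first exact: mem_head.
  by have := spine_inner spP ws nwr; lia.
exists (rcons L' (u, w)); split.
- by apply: traced_set_var => //; apply: run_emit => //; exact: q_gt0 euw.
- exact: progress_leaf.
apply: upto => [v|_ _]; rewrite mem_order_rcons ?eqxx // => ->; exact: orbT.
Qed.

Lemma run_spine_loop L s b m :
  env s -> traced L s -> progress L b m -> b < m -> b < size sp ->
  var s vCur = nth r sp b -> var s vRow = nth r sp b * n ->
  var s vNext = nth r sp b ->
  let b' := if b.+1 < size sp then b.+1 else b in
  let s' := run (PFor vJ spine_step) s in
  exists L', [/\ traced L' s', progress L' b' m & var s' vNext = nth r sp b'].
Proof.
move=> E T P bm lt_b hc hr hx /=; have hn := has_n (env_graph E).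
set b' := if _ then _ else _.
(* Either the scan has not yet passed the next spine vertex, or the move is made. When the scan ends
   at [n], the first case leaves only [b] last on the spine. *)
suff [L' [T' []]] : let s' := run (PFor vJ spine_step) s in
    exists L', [/\ traced L' s' &
      [/\ progress L' b m, var s' vNext = nth r sp b
        & b.+1 < size sp -> var s vN <= nth r sp b.+1] \/
      [/\ progress L' b.+1 m, var s' vNext = nth r sp b.+1 & b.+1 < size sp]].
- case=> P' hx' H'; exists L'; rewrite /b'; case: ifP => [/H'|_]; last by split.
  by rewrite hn leqNgt ltn_ord.
- by case=> P' hx' H'; exists L'; rewrite /b' H'.
apply: (run_for (I := fun j s' => exists L', [/\ traced L' s' &
      [/\ progress L' b m, var s' vNext = nth r sp b
        & b.+1 < size sp -> j <= nth r sp b.+1] \/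
      [/\ progress L' b.+1 m,
        var s' vNext = nth r sp b.+1 & b.+1 < size sp]])) => //.
  by exists L; split; [exact: traced_set_var|left].
move=> j s1; rewrite hn => lt_j hs hj [{T P}L' [T P]].
have E1 : env s1 by apply: agree_env hs E.
set u := nth r sp b in hc hr P *; pose w := Ordinal lt_j.
have hc1 : var s1 vCur = u by rewrite (proj1 hs).
have hr1 : var s1 vRow = u * n by rewrite (proj1 hs).
have same : (w \notin order L' -> ~~ e u w) ->
  exists L1, traced L1 (set_var s1 vJ j.+1) /\
    ([/\ progress L1 b m, var s1 vNext = u
      & b.+1 < size sp -> j < nth r sp b.+1] \/
    [/\ progress L1 b.+1 m, var s1 vNext = nth r sp b.+1 & b.+1 < size sp]).
  move=> hw; exists L'; split; first exact: traced_set_var.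
  case: P => [[P hx1 le_j]|]; [left|by right]; split=> // lt_b1.
  rewrite ltn_neqAle le_j // andbT; apply: contraL lt_b1 => /eqP eq_j.
  have eq_w : w = nth r sp b.+1 by exact: val_inj.
  apply/negP => lt_b1; have := hw;
    rewrite eq_w (pr_new P) ?ltnS ?leqnn // => /(_ isT).
  by rewrite (spine_edge spP) ?eqxx.
rewrite run_if (eval_adjacent E1 hr1 (w := w)) //.
case euw: (e u w); rewrite /= ?run_skip; last by apply: same => _; rewrite euw.
rewrite run_if /= hj -[j in arr _ _ j]/(val w) (tr_seen T).
case: ifPn => [seen|unseen]; first by rewrite run_skip; apply: same;
  rewrite seen.
case: P => [[P hx1 le_j]|[P _ _]]; last first.
  (* After the move, a second unseen neighbour would force [b = b.+1]. *)
  by have [_ _] := unseen_neighbour P bm (leqnSn b) lt_b euw unseen; lia.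
have [eq_w lt_b1 _] := unseen_neighbour P bm (leqnn b) lt_b euw unseen.
exists (rcons L' (u, w)); rewrite run_seq run_assign; split.
  do 2 apply: traced_set_var => //; apply: run_emit => //; exact: q_gt0 euw.
right; rewrite /= run_var // hj -eq_w; split=> //.
by rewrite eq_w; exact: progress_spine.
Qed.

Lemma run_walk s : env s -> var s vRoot = r ->
  var s vBase = 0 -> var s vCount = 0 ->
  (forall p, arr s aSeen p = 0) -> (forall p, arr s aOut p = 0) ->
  exists2 L, traced L (run walk s) & progress L (size sp).-1 n.
Proof.
move=> E hroot hb hct hs ho; have hn := has_n (env_graph E).
have sz0 : 0 < size sp := spine_size spP.
have sz : size sp <= n.
  by have /card_uniqP <- := spine_uniq spP; rewrite -[leqRHS]card_ord max_card.
rewrite run_seq run_seq run_assign run_put; set s0 := set_cell _ _ _ _.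
have E0 : env s0 by case: E => -[? ?] [?] ?.
have T0 : traced [::] s0.
  split=> [w|i x| |] /=; rewrite ?div0n ?mod0n //.
    by rewrite hroot hs inE -val_eqE /=; case: (_ == val r).
  by rewrite ho !inE.
(* The position advances by one per pass and then stays at the end, whence [minn]; [n] passes reach
   the end because [size sp <= n]. *)
suff [L [T P _]] : let s' := run (PFor vI walk_step) s0 in
    exists L, let b := minn (var s0 vN) (size sp).-1 in
    [/\ traced L s', progress L b (var s0 vN) & var s' vCur = nth r sp b].
  exists L => //; rewrite (has_n (env_graph E0)) in P.
  by rewrite (minn_idPr _) in P; [|lia].
apply: (run_for (I := fun j s' => exists L, let b := minn j (size sp).-1 in
    [/\ traced L s', progress L b j & var s' vCur = nth r sp b])) => //.
  exists [::]; rewrite min0n; split; first exact: traced_set_var.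
    exact: progress_nil.
  by rewrite /= (spine_head spP).
move=> j s1 lt_j hs1 hj [L]; set b := minn j _; case=> T P hc.
have E1 : env s1 by apply: agree_env hs1 E0.
have lt_b : b < size sp by rewrite /b; lia.
rewrite run_seq; set s2 := run (row vCur) s1.
have E2 : env s2 by apply: agree_env (agree_run _ _) E1.
have T2 : traced L s2 by apply: agree_traced (agree_run _ _) T.
have hc2 : var s2 vCur = nth r sp b by rewrite run_var.
have hr2 : var s2 vRow = nth r sp b * n by rewrite (row_eq (env_graph E1)) //
  hc.
have [L3 [T3 P3 done]] := run_leaf_loop E2 T2 P lt_b hc2 hr2.
rewrite run_seq; set s3 := run (PFor vJ leaf_step) s2 in T3 *.
have E3 : env s3 by apply: agree_env (agree_run _ _) E2.
rewrite run_seq run_assign; set s4 := set_var s3 _ _.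
have E4 : env s4 by case: E3 => -[? ?] [?] ?.
have T4 : traced L3 s4 by exact: traced_set_var.
have hc3 : var s3 vCur = nth r sp b by rewrite run_var.
have hr3 : var s3 vRow = nth r sp b * n by rewrite run_var.
have P4 : progress L3 b j.+1 by apply: progress_next done => //; rewrite /b;
  lia.
have bj : b < j.+1 by rewrite /b; lia.
have [L5 [T5 P5 hx5]] := run_spine_loop E4 T4 P4 bj lt_b hc3 hr3 hc3.
have eb : (if b.+1 < size sp then b.+1 else b) = minn j.+1 (size sp).-1.
  by rewrite /b; case: ifP; lia.
exists L5; rewrite -eb run_seq run_assign; split=> //.
by do 2 apply: traced_set_var => //.
Qed.

(** At the end every spine vertex is listed by [pr_old], and every other vertex by [pr_leaf], its
    spine neighbour having index below [n]. *)
Lemma walk_optimal L k (W : 'I_k -> {set 'I_n}) : progress L (size sp).-1 n ->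
  n.-1 <= q * k -> (q = 0 \/ q.-1 * k < n.-1) ->
  (forall i, W i = block q L i) -> optimal_cover e W.
Proof.
move=> P le_q lt_q hW.
have sz : size sp <= n.
  by have /card_uniqP <- := spine_uniq spP; rewrite -[leqRHS]card_ord max_card.
have hV v : v \in order L.
  have [vs|nv] := boolP (v \in sp).
    rewrite -(nth_index r vs); apply: pr_old P _ _.
    by rewrite -ltnS prednK ?index_mem ?(spine_size spP).
  have [_ [u us euv]] := spine_leaf spP nv; rewrite -(nth_index r us) in euv.
  apply: (pr_leaf P nv) euv; last by rewrite index_mem.
  by apply: leq_trans sz; rewrite index_mem.
apply: (block_optimal (pr_order P) hV _ _ _ hW); rewrite ?card_ord //.
apply: spine_order_complete sg spP _ hV (pr_index P).
exact: eo_edge (pr_order P).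
Qed.

End Walk.

(** * Assembly of the program and its running time *)

Definition main : prog := PSeq degrees (PSeq find_root (PSeq capacity walk)).

Lemma input_graph n k (e : rel 'I_n) : has_graph e (input k e).
Proof.
split=> // i j /=; congr nat_of_bool.
apply/existsP/idP=> [[i' /existsP[j']]|eij].
  by rewrite cell_eq => /andP[/andP[/eqP/val_inj-> /eqP->]].
by exists i; apply/existsP; exists j; rewrite eqxx.
Qed.

Lemma main_optimal n k (e : rel 'I_n) : caterpillar e -> 0 < k ->
  optimal_cover e (@output n k (run main (input k e))).
Proof.
move=> cat k0; have [[sg V0 _ _] _] := cat; rewrite card_ord in V0.
rewrite run_seq; have G := input_graph k e; set s1 := run degrees _.
have G1 : has_graph e s1 by apply: agree_graph (agree_run _ _) G.
have D1 : has_degrees e s1 by exact: run_degrees.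
rewrite run_seq; have [r hr /(caterpillar_spine cat)[sp spP]] := run_find_root
  V0 G1 D1.
set s2 := run find_root s1 in hr *.
have G2 : has_graph e s2 by apply: agree_graph (agree_run _ _) G1.
have D2 : has_degrees e s2 by apply: agree_degrees (agree_run _ _) D1.
rewrite run_seq; have [|le_q lt_q] := run_capacity k0 (has_n G2).
  by rewrite !run_var.
set s3 := run capacity s2 in le_q lt_q *; set q := var s3 vQ in le_q lt_q.
have E3 : env e q s3.
  split=> //; first exact: agree_graph (agree_run _ _) G2.
  exact: agree_degrees (agree_run _ _) D2.
(* An edge has distinct ends, so [n.-1] is positive and [q = 0] would violate [le_q]. *)
have q_gt0 u w : e u w -> 0 < q.
  move=> euw; have : u != w by apply: contraTneq euw => ->; rewrite (proj2 sg).
  by rewrite -val_eqE /=; have := ltn_ord u; have := ltn_ord w; nia.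
have hr3 : var s3 vRoot = r by rewrite run_var.
have [||||L T P] := run_walk sg spP q_gt0 E3 hr3.
- by rewrite !run_var.
- by rewrite !run_var.
- by move=> p; rewrite !run_arr.
- by move=> p; rewrite !run_arr.
apply: (walk_optimal sg spP P le_q lt_q) => i; apply/setP=> x.
by rewrite inE (tr_out T).
Qed.

Theorem mainTheorem3 :
  exists (c : cmd) (a d : nat),
    forall (n k : nat) (e : rel 'I_n),
      caterpillar e -> 0 < k ->
      exists (t : nat) (s : state),
        [/\ exec c (input k e) t s,
            t <= a * input_size n k ^ d
          & optimal_cover e (@output n k s)].
Proof.
have [a [d time_le]] := time_poly main.
exists (compile main), a, d => n k e cat k0.
have [//|t ex_t le_t] := @exec_compile main (input k e).
exists t, (run main (input k e)); split=> //; last exact: main_optimal.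
apply: leq_trans le_t (leq_trans (time_le _) _).
(* It remains to compare bases: [n.+1] is at most [input_size n k], whose last summand is at least
   1. Exponent 0 is separate because [leq_exp2r] wants a positive one. *)
rewrite leq_mul2l; apply/orP; right; case: (d) => // d'.
have le_nn : n <= n * n by case: (n) => // m; rewrite leq_pmulr.
by rewrite leq_exp2r //= /input_size; lia.
Qed.
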